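(* Let $d_1\ge 2$ be an integer and consider the complex system $$\dot x_1=-2x_1u_1,\qquad \dot x_2=x_2u_2,\qquad \dot u_1=-u_1u_2+\tfrac1{d_1}x_1,\qquad \dot u_2=-d_1u_1^2 .$$ Consider expansions about $t=0$ $$x_1=a_0t^{\alpha}+\dots,\quad x_2=b_0t^{\beta}+\dots,\quad u_1=c_0t^{\gamma}+\dots,\quad u_2=e_0t^{\epsilon}+\dots$$ that are singular at $t=0$ and satisfy the leading-order balance. Then $\gamma=-1$, $\epsilon=-1$, and one of the following two possibilities holds: (i) $\alpha=-2$, $a_0=d_1(d_1-1)$, $c_0=1$, $\beta=d_1$, $e_0=d_1$, and $b_0$ is arbitrary; or (ii) $c_0=\pm 1/\sqrt{d_1}$, $\alpha=\mp 2/\sqrt{d_1}$ (with corresponding signs), $\beta=1$, $e_0=1$, and $a_0$, $b_0$ are arbitrary.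
   Context: Expansions: exponents $\alpha,\beta,\gamma,\epsilon$ are real, the leading coefficients $a_0,b_0,c_0,e_0$ are nonzero complex numbers, and dots denote terms with higher powers of $t$. The expansions are called singular if at least one of the leading exponents $\alpha,\beta,\gamma,\epsilon$ is negative. Leading-order balance: after substitution, the potentially leading terms on the left : right sides of the equations are $$a_0\alpha t^{\alpha-1} : -2a_0c_0t^{\alpha+\gamma};\qquad b_0\beta t^{\beta-1} : b_0e_0t^{\beta+\epsilon};$$ $$c_0\gamma t^{\gamma-1} : -c_0e_0t^{\gamma+\epsilon},\ d_1^{-1}a_0t^{\alpha};\qquad e_0\epsilon t^{\epsilon-1} : -d_1c_0^2t^{2\gamma}.$$ The balance holds if in each of the four lines, at the smallest exponent of $t$ appearing among the listed monomials of that line, the total coefficient on the left equals the total coefficient on the right. ''Arbitrary'' means that every nonzero value is allowed by the balance. *)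

(* Defs.v *)
From Stdlib Require Import Reals List.
From Coquelicot Require Import Coquelicot.
Import ListNotations.
Open Scope R_scope.

(** The monomial [coef * t ^ expo] in a formal variable [t], with a real
    exponent.  The coefficient may vanish: [mderiv] of a constant is the
    monomial [0 * t ^ (-1)], which still counts as a listed monomial. *)
Record monomial := Mono { coef : C; expo : R }.

Definition mscale (k : C) (m : monomial) : monomial :=
  Mono (k * coef m)%C (expo m).

Definition mmul (m n : monomial) : monomial :=
  Mono (coef m * coef n)%C (expo m + expo n).

Definition mderiv (m : monomial) : monomial :=
  Mono (coef m * RtoC (expo m))%C (expo m - 1).

(** A formal expansion is given by its coefficient function: [f r] is the
    coefficient of [t ^ r].  Nothing is required of the exponents of the higher
    terms, since only the leading terms enter the balance. *)
Definition expands (f : R -> C) (m : monomial) : Prop :=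
  coef m <> RtoC 0 /\ f (expo m) = coef m /\
  forall r : R, r < expo m -> f r = RtoC 0.

Definition singular (x1 x2 u1 u2 : monomial) : Prop :=
  expo x1 < 0 \/ expo x2 < 0 \/ expo u1 < 0 \/ expo u2 < 0.

Fixpoint coef_at (s : R) (l : list monomial) : C :=
  match l with
  | [] => RtoC 0
  | m :: l' =>
      if Req_EM_T (expo m) s then (coef m + coef_at s l')%C else coef_at s l'
  end.

Definition least_expo (s : R) (l : list monomial) : Prop :=
  In s (map expo l) /\ forall m : monomial, In m l -> s <= expo m.

Definition balanced (lhs rhs : list monomial) : Prop :=
  exists s : R, least_expo s (lhs ++ rhs) /\ coef_at s lhs = coef_at s rhs.

(** Leading monomials substituted into
    [x1' = - 2 x1 u1],  [x2' = x2 u2],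
    [u1' = - u1 u2 + x1 / d1],  [u2' = - d1 u1 ^ 2]. *)
Definition leading_order_balance (d1 : nat) (x1 x2 u1 u2 : monomial) : Prop :=
  balanced [mderiv x1] [mscale (RtoC (-2)) (mmul x1 u1)] /\
  balanced [mderiv x2] [mmul x2 u2] /\
  balanced [mderiv u1]
    [mscale (RtoC (-1)) (mmul u1 u2); mscale (RtoC (/ INR d1)) x1] /\
  balanced [mderiv u2] [mscale (RtoC (- INR d1)) (mmul u1 u1)].

(* Main.v *)
Require Import Defs.
From Stdlib Require Import Reals List Lra.
From Coquelicot Require Import Coquelicot.
Import ListNotations.
Open Scope R_scope.

(** The equations for [x1] and [u2] force [gamma >= -1] and [epsilon - 1 <= 2 gamma].
    If [gamma > -1], then [alpha = 0], [epsilon > -1] and being singular means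
    [gamma < 0]; now [u1'] alone is leading in the third equation, which gives the
    contradiction [gamma = 0].  Hence
    [gamma = epsilon = -1], so that [alpha = - 2 c0], [beta = e0] and
    [e0 = d1 c0 ^ 2].  The third equation then separates [alpha = -2], where the
    term [x1 / d1] contributes, from [alpha > -2], where it does not. *)

Lemma least_expo_unique (l : list monomial) (s s' : R) :
  least_expo s l -> least_expo s' l -> s = s'.
Proof.
intros [Hs Ls] [Hs' Ls'].
apply in_map_iff in Hs as [m [<- Hm]].
apply in_map_iff in Hs' as [m' [<- Hm']].
specialize (Ls _ Hm'). specialize (Ls' _ Hm). lra.
Qed.

(** Since the least exponent is unique, the existential in [balanced] can be evaluated at any
    exponent already known to be least. *)
Lemma balanced_at (lhs rhs : list monomial) (s : R) :
  least_expo s (lhs ++ rhs) ->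
  balanced lhs rhs <-> coef_at s lhs = coef_at s rhs.
Proof.
intros Hs; split.
- intros [s' [Hs' H]]. now rewrite (least_expo_unique _ _ _ Hs Hs').
- intros H. now exists s.
Qed.

Lemma coef_at_cons_eq (s : R) (m : monomial) (l : list monomial) :
  expo m = s -> coef_at s (m :: l) = (coef m + coef_at s l)%C.
Proof. intros H; simpl. now destruct (Req_EM_T (expo m) s). Qed.

Lemma coef_at_cons_neq (s : R) (m : monomial) (l : list monomial) :
  expo m <> s -> coef_at s (m :: l) = coef_at s l.
Proof. intros H; simpl. now destruct (Req_EM_T (expo m) s). Qed.

(** Each test [expo m = s] is settled by linear arithmetic from the context, so a case split on the
    exponents must come first. *)
Ltac eval_coef_at H :=
  repeat first [rewrite coef_at_cons_eq in H by (simpl; lra)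
               |rewrite coef_at_cons_neq in H by (simpl; lra)];
  cbn [coef_at coef mscale mmul mderiv expo] in H.

Ltac eval_coef_at_goal :=
  repeat first [rewrite coef_at_cons_eq by (simpl; lra)
               |rewrite coef_at_cons_neq by (simpl; lra)];
  cbn [coef_at coef mscale mmul mderiv expo].

Ltac solve_least_expo :=
  split; [simpl; solve [repeat first [left; lra | right]]
         |let m := fresh in let H := fresh in
          intros m H; simpl in H;
          repeat (destruct H as [<-|H]; [simpl; lra|]); destruct H].

(** Trichotomy on the exponents: a monomial that leads alone faces [0] on the other side, so its
    coefficient must vanish. *)
Lemma balanced_pair (m n : monomial) :
  balanced [m] [n] <->
  (expo m < expo n /\ coef m = RtoC 0) \/
  (expo n < expo m /\ coef n = RtoC 0) \/
  (expo m = expo n /\ coef m = coef n).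
Proof.
destruct (Rtotal_order (expo m) (expo n)) as [H|[H|H]].
- rewrite (balanced_at _ _ (expo m)) by solve_least_expo.
  eval_coef_at_goal. rewrite Cplus_0_r. intuition lra.
- rewrite (balanced_at _ _ (expo m)) by solve_least_expo.
  eval_coef_at_goal. rewrite !Cplus_0_r. intuition lra.
- rewrite (balanced_at _ _ (expo n)) by solve_least_expo.
  eval_coef_at_goal. rewrite Cplus_0_r. intuition (try lra; congruence).
Qed.

Lemma RtoC_neq0 (x : R) : x <> 0 -> RtoC x <> RtoC 0.
Proof. intros H E. now apply H, RtoC_inj. Qed.

Lemma Cmult_RtoC_eq0 (z : C) (x : R) :
  z <> RtoC 0 -> (z * RtoC x)%C = RtoC 0 -> x = 0.
Proof.
intros Hz H. destruct (Req_EM_T x 0) as [|Hx]; [assumption|].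
now destruct (Cmult_neq_0 _ _ Hz (RtoC_neq0 _ Hx)).
Qed.

Lemma Cmult_cancel_l (z x y : C) :
  z <> RtoC 0 -> (z * x)%C = (z * y)%C -> x = y.
Proof.
intros Hz H.
replace x with (/ z * (z * x))%C by (field; assumption).
rewrite H. field; assumption.
Qed.

Lemma INR_ge2 (n : nat) : (2 <= n)%nat -> 2 <= INR n.
Proof. exact (le_INR 2 n). Qed.

(** The product coefficient [-2 a0 c0] is nonzero, so the right side cannot lead alone. If the left
    does, [a0 alpha = 0]; if the exponents agree, cancelling [a0] makes [c0] real. The equations for
    [x2] and [u2] are treated in the same way. *)
Lemma x1_balance (a0 c0 : C) (alpha gamma : R) :
  a0 <> RtoC 0 -> c0 <> RtoC 0 ->
  balanced [mderiv (Mono a0 alpha)]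
           [mscale (RtoC (-2)) (mmul (Mono a0 alpha) (Mono c0 gamma))] ->
  (-1 < gamma /\ alpha = 0) \/ (gamma = -1 /\ c0 = RtoC (- alpha / 2)).
Proof.
intros Ha Hc H; apply balanced_pair in H; simpl in H.
destruct H as [[H1 H2]|[[H1 H2]|[H1 H2]]].
- left; split; [lra|]. exact (Cmult_RtoC_eq0 _ _ Ha H2).
- exfalso; revert H2. repeat apply Cmult_neq_0; auto. apply RtoC_neq0; lra.
- right; split; [lra|].
  assert (E : RtoC alpha = (RtoC (-2) * c0)%C).
  { apply (Cmult_cancel_l a0); [assumption|]. rewrite H2. ring. }
  replace (- alpha / 2) with (/ -2 * alpha) by field.
  rewrite RtoC_mult, E, RtoC_inv by lra. field.
Qed.

Lemma x2_balance (b0 e0 : C) (beta epsilon : R) :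
  b0 <> RtoC 0 -> e0 <> RtoC 0 ->
  balanced [mderiv (Mono b0 beta)] [mmul (Mono b0 beta) (Mono e0 epsilon)] ->
  (-1 < epsilon /\ beta = 0) \/ (epsilon = -1 /\ e0 = RtoC beta).
Proof.
intros Hb He H; apply balanced_pair in H; simpl in H.
destruct H as [[H1 H2]|[[H1 H2]|[H1 H2]]].
- left; split; [lra|]. exact (Cmult_RtoC_eq0 _ _ Hb H2).
- exfalso; revert H2. apply Cmult_neq_0; auto.
- right; split; [lra|]. symmetry. now apply (Cmult_cancel_l b0).
Qed.

Lemma u2_balance (d1 : nat) (c0 e0 : C) (gamma epsilon : R) :
  (2 <= d1)%nat -> c0 <> RtoC 0 -> e0 <> RtoC 0 ->
  balanced [mderiv (Mono e0 epsilon)]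
           [mscale (RtoC (- INR d1)) (mmul (Mono c0 gamma) (Mono c0 gamma))] ->
  (epsilon - 1 < 2 * gamma /\ epsilon = 0) \/
  (epsilon - 1 = 2 * gamma /\
   (e0 * RtoC epsilon)%C = (RtoC (- INR d1) * (c0 * c0))%C).
Proof.
intros hd1 Hc He H; pose proof (INR_ge2 _ hd1) as Hd.
apply balanced_pair in H; simpl in H.
destruct H as [[H1 H2]|[[H1 H2]|[H1 H2]]].
- left; split; [lra|]. exact (Cmult_RtoC_eq0 _ _ He H2).
- exfalso; revert H2. repeat apply Cmult_neq_0; auto. apply RtoC_neq0; lra.
- right; split; [lra|assumption].
Qed.

Lemma singular_balance_poles (d1 : nat) (a0 b0 c0 e0 : C)
    (alpha beta gamma epsilon : R) :
  (2 <= d1)%nat ->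
  a0 <> RtoC 0 -> b0 <> RtoC 0 -> c0 <> RtoC 0 -> e0 <> RtoC 0 ->
  singular (Mono a0 alpha) (Mono b0 beta) (Mono c0 gamma) (Mono e0 epsilon) ->
  leading_order_balance d1
    (Mono a0 alpha) (Mono b0 beta) (Mono c0 gamma) (Mono e0 epsilon) ->
  gamma = -1 /\ epsilon = -1 /\ c0 = RtoC (- alpha / 2) /\ e0 = RtoC beta /\
  4 * beta = INR d1 * alpha ^ 2.
Proof.
intros hd1 Ha Hb Hc He Hs (H1 & H2 & H3 & H4); unfold singular in Hs; simpl in Hs.
apply x1_balance in H1; auto; apply x2_balance in H2; auto;
apply u2_balance in H4; auto.
destruct H1 as [[Hg Hal]|[Hg Hc0]].
- exfalso.
  (* The [u2] equation leaves [epsilon = 0] or [epsilon = 2 gamma + 1], both above [-1]; then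
     [alpha = beta = 0], and a negative [epsilon] would also make [gamma] negative. *)
  assert (Hneg : gamma < 0 /\ -1 < epsilon) by (destruct H2, H4; lra).
  rewrite (balanced_at _ _ (gamma - 1)) in H3 by solve_least_expo.
  eval_coef_at H3. rewrite !Cplus_0_r in H3.
  apply Cmult_RtoC_eq0 in H3; [lra|assumption].
- assert (Hep : epsilon = -1) by (destruct H2, H4; lra).
  destruct H2 as [[? _]|[_ He0]]; [lra|].
  destruct H4 as [[_ ?]|[_ H4]]; [lra|].
  repeat split; auto.
  (* With [c0] and [e0] real, the [u2] balance becomes the real equation
     [- beta = - d1 (alpha / 2) ^ 2]. *)
  rewrite He0, Hc0, Hep, <- !RtoC_mult in H4. apply RtoC_inj in H4. nra.
Qed.

Theorem proposition3p1 (d1 : nat) (hd1 : (2 <= d1)%nat) :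
  (forall (x1 x2 u1 u2 : R -> C) (a0 b0 c0 e0 : C)
          (alpha beta gamma epsilon : R),
     expands x1 (Mono a0 alpha) ->
     expands x2 (Mono b0 beta) ->
     expands u1 (Mono c0 gamma) ->
     expands u2 (Mono e0 epsilon) ->
     singular (Mono a0 alpha) (Mono b0 beta) (Mono c0 gamma) (Mono e0 epsilon) ->
     leading_order_balance d1
       (Mono a0 alpha) (Mono b0 beta) (Mono c0 gamma) (Mono e0 epsilon) ->
     gamma = -1 /\ epsilon = -1 /\
     ((alpha = -2 /\ a0 = RtoC (INR d1 * (INR d1 - 1)) /\ c0 = RtoC 1 /\
       beta = INR d1 /\ e0 = RtoC (INR d1))
      \/
      (((c0 = RtoC (1 / sqrt (INR d1)) /\ alpha = - (2 / sqrt (INR d1))) \/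
        (c0 = RtoC (- (1 / sqrt (INR d1))) /\ alpha = 2 / sqrt (INR d1))) /\
       beta = 1 /\ e0 = RtoC 1)))
  /\
  (forall b0 : C, b0 <> RtoC 0 ->
     leading_order_balance d1
       (Mono (RtoC (INR d1 * (INR d1 - 1))) (-2)) (Mono b0 (INR d1))
       (Mono (RtoC 1) (-1)) (Mono (RtoC (INR d1)) (-1)))
  /\
  (forall a0 b0 : C, a0 <> RtoC 0 -> b0 <> RtoC 0 ->
     leading_order_balance d1
       (Mono a0 (- (2 / sqrt (INR d1)))) (Mono b0 1)
       (Mono (RtoC (1 / sqrt (INR d1))) (-1)) (Mono (RtoC 1) (-1))
     /\
     leading_order_balance d1
       (Mono a0 (2 / sqrt (INR d1))) (Mono b0 1)
       (Mono (RtoC (- (1 / sqrt (INR d1)))) (-1)) (Mono (RtoC 1) (-1))).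
Proof.
assert (Hd : 2 <= INR d1) by now apply INR_ge2.
assert (Hsq : sqrt (INR d1) * sqrt (INR d1) = INR d1) by (apply sqrt_sqrt; lra).
assert (Hs1 : 1 < sqrt (INR d1)) by (pose proof (sqrt_pos (INR d1)); nra).
assert (Hinv : 0 < / sqrt (INR d1) < 1).
{ split; [apply Rinv_0_lt_compat; lra|].
  rewrite <- Rinv_1. apply Rinv_lt_contravar; lra. }
assert (Hinv2 : INR d1 * (/ sqrt (INR d1) * / sqrt (INR d1)) = 1).
{ rewrite <- Hsq at 1. field. lra. }
(* From here on only [0 < q < 1] and [d1 q ^ 2 = 1] matter; the bound [q < 1] comes from
   [d1 >= 2]. *)
set (q := / sqrt (INR d1)) in *.
replace (1 / sqrt (INR d1)) with q by (unfold q; field; lra).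
replace (2 / sqrt (INR d1)) with (2 * q) by (unfold q; field; lra).
clearbody q.
split; [|split].
- intros x1 x2 u1 u2 a0 b0 c0 e0 alpha beta gamma epsilon
    [Ha _] [Hb _] [Hc _] [He _] Hsing Hbal.
  simpl in Ha, Hb, Hc, He.
  destruct (singular_balance_poles d1 a0 b0 c0 e0 alpha beta gamma epsilon)
    as (Hg & Hep & Hc0 & He0 & Hbeta); auto.
  destruct Hbal as (_ & _ & H3 & _).
  subst gamma epsilon c0 e0.
  split; [reflexivity|split; [reflexivity|]].
  (* In the third equation [u1'] and [u1 u2] both have exponent [-2], to be compared with the
     exponent [alpha] of [x1 / d1]. If [alpha < -2], that term leads alone, although [a0 / d1] is
     nonzero. *)
  destruct (Rtotal_order alpha (-2)) as [Hlt|[Heq|Hgt]].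
  + exfalso. rewrite (balanced_at _ _ alpha) in H3 by solve_least_expo.
    eval_coef_at H3. rewrite !Cplus_0_r in H3. symmetry in H3; revert H3.
    apply Cmult_neq_0; [|assumption].
    apply RtoC_neq0, Rinv_neq_0_compat; lra.
  + left. subst alpha.
    rewrite (balanced_at _ _ (-2)) in H3 by solve_least_expo.
    eval_coef_at H3. rewrite !Cplus_0_r in H3.
    assert (Hb' : beta = INR d1) by lra. subst beta.
    repeat split; try (f_equal; lra).
    (* Here [c0 = 1] and [e0 = d1], so the third balance reads [-1 = - d1 + a0 / d1], which is
       solved for [a0]. *)
    apply (Cmult_cancel_l (RtoC (/ INR d1))).
    { apply RtoC_neq0, Rinv_neq_0_compat; lra. }
    replace (RtoC (/ INR d1) * a0)%C
      with (RtoC (- (-2) / 2) * RtoC (-1)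
            - RtoC (-1) * (RtoC (- (-2) / 2) * RtoC (INR d1)))%C
      by (rewrite H3; ring).
    rewrite <- !RtoC_mult, <- RtoC_minus. f_equal. field. lra.
  + right.
    rewrite (balanced_at _ _ (-2)) in H3 by solve_least_expo.
    eval_coef_at H3. rewrite !Cplus_0_r, <- !RtoC_mult in H3.
    apply RtoC_inj in H3.
    assert (Hal : alpha <> 0) by (intros ->; apply Hc; f_equal; lra).
    (* Without [x1 / d1] the third balance is [alpha = alpha beta]. *)
    assert (Hb1 : beta = 1) by (apply (Rmult_eq_reg_l alpha); lra).
    subst beta.
    (* Now [d1 alpha ^ 2 = 4 = d1 (2 q) ^ 2]; the two factors give the two signs in (ii). *)
    assert (Hal2 : (alpha + 2 * q) * (alpha - 2 * q) = 0).
    { apply (Rmult_eq_reg_l (INR d1)); nra. }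
    split; [|split; reflexivity].
    apply Rmult_integral in Hal2 as [E|E]; [left|right];
      split; try lra; f_equal; lra.
- intros b0 _. split; [|split; [|split]].
  + apply balanced_pair; right; right; simpl; split; [lra|].
    rewrite <- !RtoC_mult; f_equal; ring.
  + apply balanced_pair; right; right; simpl; split; [lra|reflexivity].
  (* All three monomials have exponent [-2], and [-1 = - d1 + (d1 - 1)]. *)
  + apply (balanced_at _ _ (-2)); [solve_least_expo|].
    eval_coef_at_goal. rewrite <- !RtoC_mult, <- !RtoC_plus; f_equal. field; lra.
  + apply balanced_pair; right; right; simpl; split; [lra|].
    rewrite <- !RtoC_mult; f_equal; ring.
(* Both signs are covered by [r = q] and [r = - q]. The condition [r < 1] places the exponent [-2 r]
   of [x1] above [-2], so [a0] does not enter the third balance. *)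
- assert (Hcase : forall (r : R) (a0 b0 : C), INR d1 * (r * r) = 1 -> r < 1 ->
    leading_order_balance d1 (Mono a0 (- (2 * r))) (Mono b0 1)
      (Mono (RtoC r) (-1)) (Mono (RtoC 1) (-1))).
  { intros r a0 b0 Hr Hr1. split; [|split; [|split]].
    + apply balanced_pair; right; right; simpl; split; [lra|].
      replace (- (2 * r)) with (-2 * r) by ring. rewrite RtoC_mult; ring.
    + apply balanced_pair; right; right; simpl; split; [lra|reflexivity].
    + apply (balanced_at _ _ (-2)); [solve_least_expo|].
      eval_coef_at_goal. rewrite <- !RtoC_mult, <- !RtoC_plus; f_equal. ring.
    + apply balanced_pair; right; right; simpl; split; [lra|].
      rewrite <- !RtoC_mult; f_equal; lra. }
  intros a0 b0 _ _. split.
  + now apply Hcase.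
  + replace (2 * q) with (- (2 * - q)) by ring. apply Hcase; lra.
Qed.
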